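(* Let $q$ be a prime power and $N,t$ integers with $N\geq 1$ and $1\leq t\leq N+1$. There is a $t$-fold strong blocking set $\mathcal{B}$ in $\mathrm{PG}(N,q)$ consisting of the points of $m$ subspaces of dimension $N-t+1$, where \[m=\lceil (N-t+2)(t-1)c_1(q)+c_2(q)\rceil,\] with \[c_1(q)=\frac{-\ln q}{\ln(1-e^{-\frac{1}{q-2}})},\quad c_2(q)=\frac{-1}{(q-2)\ln(1-e^{-\frac{1}{q-2}})}\quad\text{for } q>2,\] \[c_1(2)=\frac{-\ln 2}{\ln(1-0.5e^{-\frac{2}{3}})},\quad c_2(2)=\frac{-\ln(2e^{2/3})}{\ln(1-0.5e^{-\frac{2}{3}})}.\]
   Context: $\mathrm{PG}(N,q)$ is the $N$-dimensional projective space over $\mathbb{F}_q$. A $t$-fold strong blocking set of $\mathrm{PG}(N,q)$ is a point set that meets every $(t-1)$-dimensional subspace $\Lambda$ in a set of points spanning $\Lambda$. *)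

(* Defs.v *)
From HB Require Import structures.
From mathcomp Require Import all_boot all_order all_algebra.
From mathcomp Require Import reals sequences exp.

Set Implicit Arguments.
Unset Strict Implicit.
Unset Printing Implicit Defensive.

Import Order.TTheory GRing.Theory Num.Theory.

Local Open Scope ring_scope.

Section VspaceFinite.

(* The subType structure of {vspace vT} lives in this module. *)
Import VectorInternalTheory.

Variables (F : finFieldType) (vT : vectType F).

HB.instance Definition _ := [Countable of {vspace vT} by <:].
HB.instance Definition _ := [Finite of {vspace vT} by <:].

End VspaceFinite.

(* The subspaces of PG(N, q), points included, are the linear subspaces of
   F_q^(N+1). *)
Notation pg_subspace F N := {vspace 'rV[F]_N.+1}.

(* Projective dimension; the empty subspace has dimension -1. *)
Definition pg_dim (F : finFieldType) (N : nat) (U : pg_subspace F N) : int :=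
  (\dim U)%:Z - 1.

Definition pg_points (F : finFieldType) (N : nat) (U : pg_subspace F N) :
    {set pg_subspace F N} :=
  [set P : pg_subspace F N | (pg_dim P == 0) && (P <= U)%VS].

Definition pg_span (F : finFieldType) (N : nat) (A : {set pg_subspace F N}) :
    pg_subspace F N :=
  (\sum_(P in A) P)%VS.

Definition strong_blocking_set (F : finFieldType) (N t : nat)
    (B : {set pg_subspace F N}) : Prop :=
  B \subset pg_points (fullv : pg_subspace F N) /\
  forall L : pg_subspace F N, pg_dim L = t%:Z - 1 ->
    pg_span (B :&: pg_points L) = L.

Definition c1 (R : realType) (q : nat) : R :=
  if q == 2%N then - ln 2 / ln (1 - 2^-1 * expR (- (2 / 3)))
  else - ln q%:R / ln (1 - expR (- (1 / (q%:R - 2)))).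

Definition c2 (R : realType) (q : nat) : R :=
  if q == 2%N
  then - ln (2 * expR (2 / 3)) / ln (1 - 2^-1 * expR (- (2 / 3)))
  else - 1 / ((q%:R - 2) * ln (1 - expR (- (1 / (q%:R - 2))))).

(* Main.v *)
(** Put n = N + 1 and s = t - 1, and let the subspaces be kernels of m random
    n x s matrices A_i acting on row vectors.  If an s-space H is the row space
    of B, then B A_i is invertible with probability
    p = prod_(1 <= i <= s) (1 - q^-i), and in that case ker A_i misses H.  Since
    there are at most q^(s(n-s)) / p such H, a family in which every H is missed
    by some kernel exists as soon as q^(s(n-s)) (1 - p)^m < p; the constants c1
    and c2 come from an explicit lower bound on p.  Such a family is strongly
    blocking: were the points on a t-space L to span less than L, they would lie
    in some H, but a kernel missing H still meets L for dimensional reasons. *)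
Require Import Defs.
From mathcomp Require Import all_boot all_order all_algebra.
From mathcomp Require Import reals sequences exp.
From mathcomp Require Import zify ring lra.

Set Implicit Arguments.
Unset Strict Implicit.
Unset Printing Implicit Defensive.

Import Order.TTheory GRing.Theory Num.Theory.

Local Open Scope ring_scope.

(** * Counting matrices; existence of a transversal family *)

Lemma card_unitmx (F : finFieldType) (s : nat) :
  #|[set G : 'M[F]_s | G \in unitmx]| =
  (#|F| ^ 'C(s, 2) * \prod_(1 <= i < s.+1) (#|F| ^ i - 1))%N.
Proof.
case: s => [|s].
  rewrite big_geq // muln1 bin0n expn0 (@eq_card _ _ predT) ?card_mx //= => M.
  by rewrite !inE [M]flatmx0 -(flatmx0 1%:M) unitmx1.
by rewrite -card_GL // cardsT /= card_sub; apply: eq_card => A; rewrite inE.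
Qed.

(** As [B] has a right inverse, [A |-> B *m A] is onto and its fibres are cosets of one kernel, of
    size [K]; the case [predT] determines [K]. So [B *m A] is uniform when [A] is. *)
Lemma card_mulmx_preim (F : finFieldType) (s n : nat) (B : 'M[F]_(s, n))
    (P : pred 'M[F]_s) : row_free B ->
  (#|[set A : 'M[F]_(n, s) | P (B *m A)]| * #|F| ^ (s * s) =
   #|P| * #|F| ^ (n * s))%N.
Proof.
case/row_freeP => C BC1.
pose K := #|[set A : 'M[F]_(n, s) | B *m A == 0]|.
have fib (Q : pred 'M[F]_s) :
    #|[set A : 'M[F]_(n, s) | Q (B *m A)]| = (#|Q| * K)%N.
  rewrite -sum1_card (partition_big (mulmx B) Q) => [|A]; last by rewrite inE.
  rewrite -sum_nat_const; apply: eq_bigr => M QM.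
  rewrite sum1_card -[RHS](card_imset _ (addrI (C *m M))).
  apply: eq_card => A; rewrite [LHS]inE inE.
  apply/andP/imsetP => [[_ /eqP BA]|[A' +  ->]].
    exists (A - C *m M); last by rewrite addrC subrK.
    by rewrite inE mulmxBr mulmxA BC1 mul1mx BA subrr.
  by rewrite inE mulmxDr mulmxA BC1 mul1mx => /eqP ->; rewrite addr0.
have := fib predT; rewrite card_mx => fibT.
rewrite fib -mulnA [(K * _)%N]mulnC -fibT -(card_mx F n s); congr (_ * _)%N.
by apply: eq_card => A; rewrite inE.
Qed.

(* Double counting of the pairs (A, B) for which no product B *m A i is
   invertible: if every family A had such a B, it would have all the G *m B,
   G invertible. *)
Lemma exists_transversal_family (F : finFieldType) (n s m : nat)
    (u := #|[set G : 'M[F]_s | G \in unitmx]|) :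
  (#|F| ^ (n * s) * (#|F| ^ (s * s) - u) ^ m < u * #|F| ^ (s * s * m))%N ->
  exists A : 'I_m -> 'M[F]_(n, s), forall B : 'M[F]_(s, n), row_free B ->
    exists i, B *m A i \in unitmx.
Proof.
move=> lt_u; pose q := #|F|.
have q0 k : (0 < q ^ k)%N by rewrite expn_gt0 (ltnW (card_finNzRing_gt1 F)).
pose bad (A : {ffun 'I_m -> 'M[F]_(n, s)}) (B : 'M[F]_(s, n)) :=
  row_free B && [forall i, B *m A i \notin unitmx].
case: (boolP [exists A, [forall B, ~~ bad A B]]) => [/existsP[A /forallP okA]|].
  exists A => B freeB; have := okA B.
  by rewrite /bad freeB negb_forall => /existsP[i]; rewrite negbK; exists i.
rewrite negb_exists => /forallP allbad; move: lt_u; rewrite ltnNge => /negP[].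
have le_u A : (u <= #|bad A|)%N.
  have := allbad A; rewrite negb_forall => /existsP[B].
  rewrite negbK => /andP[freeB /forallP badB].
  rewrite /u -(card_imset _ (row_free_inj freeB)); apply: subset_leq_card.
  apply/subsetP => _ /imsetP[G + ->]; rewrite inE => unitG.
  rewrite unfold_in /bad; apply/andP; split.
    by rewrite -row_leq_rank mxrankMfree // mxrank_unit.
  by apply/forallP => i; rewrite -mulmxA unitmx_mul unitG badB.
(* For fixed [B] the conditions on the [m] matrices [A i] are independent, hence the [m]-th
   powers. *)
have eq_bad B : row_free B ->
    (#|[pred A : {ffun 'I_m -> 'M[F]_(n, s)} | bad A B]| * q ^ (s * s * m) =
    (q ^ (s * s) - u) ^ m * q ^ (n * s * m))%N.
  move=> freeB; pose N := [set A : 'M[F]_(n, s) | B *m A \notin unitmx].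
  rewrite (@eq_card _ _ (ffun_on N)) => [|A]; last first.
    rewrite inE /bad freeB; apply/forallP/ffun_onP => h i; have := h i.
      by rewrite inE.
    by rewrite inE.
  rewrite card_ffun_on card_ord.
  rewrite (expnM q (s * s)) (expnM q (n * s)) -!expnMn; congr (_ ^ m)%N.
  rewrite [LHS](card_mulmx_preim [pred M | M \notin unitmx] freeB).
  congr (_ * _)%N.
  rewrite -card_mx -(cardsC [set G : 'M[F]_s | G \in unitmx]) addKn.
  by apply: eq_card => G; rewrite !inE.
have : (q ^ (n * s * m) * u <=
        \sum_(B : 'M[F]_(s, n)) #|[pred A | bad A B]|)%N.
  rewrite (eq_bigr (fun B => \sum_(A | bad A B) 1)%N) => [|B _]; last first.
    by rewrite sum1_card.
  rewrite (exchange_big_dep predT) //=.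
  rewrite (eq_bigr (fun A => #|bad A|)) => [|A _]; last by rewrite sum1_card.
  rewrite expnM -card_mx -[m in (_ ^ m)%N]card_ord -card_ffun -sum_nat_const.
  exact: leq_sum.
rewrite -(leq_pmul2r (q0 (s * s * m)%N)) big_distrl /= => bound.
rewrite -(leq_pmul2l (q0 (n * s * m)%N)) mulnA; apply: leq_trans bound _.
rewrite mulnCA [(n * s)%N as X in (q ^ X * _)%N]mulnC.
(* The sum runs over all [q ^ (s * n)] matrices [B]; those that are not row free contribute 0. *)
rewrite -(card_mx F s n) -sum_nat_const; apply: leq_sum => B _.
have [freeB|nfreeB] := boolP (row_free B); first by rewrite eq_bad // mulnC.
by rewrite eq_card0 // => A; rewrite inE /bad (negbTE nfreeB).
Qed.

(** * Lower bound on the probability, and the constants *)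

(* A lower bound on the probability prod_(1 <= i <= s) (1 - q^-i), uniform in s:
   1 - q^-i >= expR (- 1 / (q^i - 1)), where 1 / (q^i - 1) is at most (q - 1)^-i
   in general and at most (4/3) 2^-i for q = 2 and i >= 2. *)
Definition transversal_bound (R : realType) (q : nat) : R :=
  if q == 2%N then 2^-1 * expR (- (2 / 3)) else expR (- (1 / (q%:R - 2))).

Lemma transversal_bound_gt0 (R : realType) (q : nat) :
  0 < transversal_bound R q.
Proof.
by rewrite /transversal_bound; case: ifP => _;
  rewrite ?mulr_gt0 ?invr_gt0 ?expR_gt0.
Qed.

(** [1 - a^-1] is the inverse of [1 + (a - 1)^-1], and [1 + x <= expR x]. *)
Lemma expRN_le_1subV (R : realType) (a z : R) :
  1 < a -> (a - 1)^-1 <= z -> expR (- z) <= 1 - a^-1.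
Proof.
move=> a1 le_z.
have -> : 1 - a^-1 = (1 + (a - 1)^-1)^-1 by field; lra.
rewrite expRN lef_pV2 ?posrE ?expR_gt0 ?addr_gt0 ?invr_gt0 ?subr_gt0 //.
apply: le_trans (expR_ge1Dx _).
by rewrite lerD2l.
Qed.

Lemma transversal_bound_lt_prod (R : realType) (q s : nat) : (1 < q)%N ->
  transversal_bound R q < \prod_(1 <= i < s.+1) (1 - (q%:R ^+ i)^-1).
Proof.
rewrite /transversal_bound; have [-> _|q_neq2 q_gt1] := eqVneq q 2%N.
  case: s => [|s].
    rewrite big_geq //.
    have : expR (- (2 / 3)) < 1 :> R by rewrite expR_lt1; lra.
    by lra.
  (* The factor 1/2 for [i = 1] is kept exactly; the exponent is minus the sum of (4/3) 2^-i over 2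
     <= i <= s + 1. Stopping at a partial sum makes the final bound strict. *)
  have step : 2^-1 * expR (- (2 / 3 * (1 - (2 ^+ s)^-1))) <=
      \prod_(1 <= i < s.+2) (1 - (2%:R ^+ i)^-1) :> R.
    elim: s => [|s IHs].
      by rewrite big_nat1 expr1 expr0 invr1 subrr mulr0 oppr0 expR0; lra.
    (* With y = 2^s the new factor is 1 - 1/(4y), and 4y - 1 >= 3y. *)
    have P2 : 1 <= 2 ^+ s :> R by rewrite exprn_ege1 // ler1n.
    rewrite big_nat_recr //=; set y := 2 ^+ s in P2 IHs *.
    have -> : - (2 / 3 * (1 - (2 ^+ s.+1)^-1)) =
      - (2 / 3 * (1 - y^-1)) + - (3 * y)^-1.
      by rewrite exprS -/y; field; lra.
    rewrite expRD mulrA.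
    apply: ler_pM; rewrite ?mulr_ge0 ?invr_ge0 ?expR_ge0 //.
    apply: expRN_le_1subV; rewrite !exprS -/y; first by lra.
    by rewrite lef_pV2 ?posrE; lra.
  apply: lt_le_trans step; rewrite ltr_pM2l ?invr_gt0 // ltr_expR.
  have : 0 < (2 ^+ s)^-1 :> R by rewrite invr_gt0 exprn_gt0.
  by lra.
have q3 : 3 <= q%:R :> R by rewrite (ler_nat _ 3) ltn_neqAle eq_sym q_neq2.
set Q : R := q%:R in q3 *.
(* The exponent is minus the sum of (Q - 1)^-i over 1 <= i <= s, a geometric series with total 1/(Q
   - 2). *)
have step : expR (- ((1 - ((Q - 1) ^+ s)^-1) / (Q - 2))) <=
    \prod_(1 <= i < s.+1) (1 - (Q ^+ i)^-1).
  elim: s => [|s IHs].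
    by rewrite big_geq // expr0 invr1 subrr mul0r oppr0 expR0.
  have y1 : 1 <= (Q - 1) ^+ s by rewrite exprn_ege1 //; lra.
  have yz : (Q - 1) ^+ s <= Q ^+ s by rewrite lerXn2r ?nnegrE; lra.
  rewrite big_nat_recr //=; set y := (Q - 1) ^+ s in y1 yz IHs *.
  have -> : - ((1 - ((Q - 1) ^+ s.+1)^-1) / (Q - 2)) =
    - ((1 - y^-1) / (Q - 2)) + - ((Q - 1) * y)^-1.
    by rewrite exprS -/y; field; lra.
  rewrite expRD; apply: ler_pM; rewrite ?expR_ge0 //.
  apply: expRN_le_1subV; rewrite !exprS; first by nra.
  by rewrite lef_pV2 ?posrE; nra.
apply: lt_le_trans step; rewrite ltr_expR ltrN2 ltr_pM2r ?invr_gt0; last by lra.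
have : 0 < ((Q - 1) ^+ s)^-1 by rewrite invr_gt0 exprn_gt0 //; lra.
by lra.
Qed.

Lemma prod_1subV_le1 (R : realType) (q s : nat) : (1 < q)%N ->
  \prod_(1 <= i < s.+1) (1 - (q%:R ^+ i)^-1) <= 1 :> R.
Proof.
move=> q_gt1; apply: prodr_ile1 => i _.
have q1 : 1 <= q%:R ^+ i :> R by rewrite exprn_ege1 // ler1n ltnW.
rewrite subr_ge0 invf_le1 ?(lt_le_trans ltr01) // q1.
by rewrite gerBl invr_ge0 (le_trans ler01).
Qed.

Lemma transversal_bound_lt1 (R : realType) (q : nat) : (1 < q)%N ->
  transversal_bound R q < 1.
Proof. by move/(transversal_bound_lt_prod R 0); rewrite big_geq. Qed.

(** With [t] the transversal bound, this turns [K * c1 + c2 <= m] into K ln q + m ln(1 - t) <= ln t,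
    that is q^K (1 - t)^m <= t. *)
Lemma c1_c2E (R : realType) (q : nat) (K : R) : (1 < q)%N ->
  K * c1 R q + c2 R q =
  (K * ln q%:R - ln (transversal_bound R q)) / - ln (1 - transversal_bound R q).
Proof.
move=> q_gt1; have := transversal_bound_lt1 R q_gt1.
have := transversal_bound_gt0 R q.
rewrite /c1 /c2 /transversal_bound; have [->|q_neq2] := eqVneq q 2%N => p0 p1.
  have l0 : ln (1 - 2^-1 * expR (- (2 / 3))) < 0 :> R by apply: ln_lt0; lra.
  have -> : ln (2^-1 * expR (- (2 / 3))) = - ln (2 * expR (2 / 3)) :> R.
    by rewrite -lnV ?posrE ?mulr_gt0 ?expR_gt0 // invfM expRN.
  by field; lra.
have q2 : 2 < q%:R :> R by rewrite (ltr_nat _ 2) ltn_neqAle eq_sym q_neq2.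
have l0 : ln (1 - expR (- (1 / (q%:R - 2)))) < 0 :> R by apply: ln_lt0; lra.
by rewrite expRK; field; lra.
Qed.

(** The chain is q^k (1 - p)^m <= q^k (1 - t)^m <= t < p, with [t] the transversal bound; only the
    last step is strict. *)
Lemma union_bound_lt (R : realType) (q k m : nat) (p : R) : (1 < q)%N ->
  transversal_bound R q < p -> p <= 1 -> k%:R * c1 R q + c2 R q <= m%:R ->
  q%:R ^+ k * (1 - p) ^+ m < p.
Proof.
move=> q_gt1 lt_p p_le1; rewrite c1_c2E //.
have t0 := transversal_bound_gt0 R q; have t1 := transversal_bound_lt1 R q_gt1.
set t := transversal_bound R q in lt_p t0 t1 *.
have l0 : ln (1 - t) < 0 by apply: ln_lt0; lra.
have Q0 : 0 < q%:R :> R by rewrite ltr0n ltnW.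
rewrite ler_pdivrMr ?oppr_gt0 // => le_m; apply: le_lt_trans (lt_p).
apply: (@le_trans _ _ (q%:R ^+ k * (1 - t) ^+ m)).
  by rewrite ler_pM2l ?exprn_gt0 // lerXn2r ?nnegrE; lra.
have P1 : 0 < (1 - t) ^+ m by rewrite exprn_gt0 // subr_gt0.
have P2 : 0 < q%:R ^+ k :> R by rewrite exprn_gt0.
rewrite -ler_ln ?posrE ?mulr_gt0 // lnM ?posrE //.
rewrite !lnXn ?subr_gt0 // -[_ *+ k]mulr_natl -[_ *+ m]mulr_natl; lra.
Qed.

(** Taking q^i out of each factor q^i - 1 gives the exponent C(s, 2) + (1 + ... + s) = s^2. *)
Lemma card_unitmx_prod (R : realType) (F : finFieldType) (s : nat) :
  #|[set G : 'M[F]_s | G \in unitmx]|%:R =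
  #|F|%:R ^+ (s * s) * \prod_(1 <= i < s.+1) (1 - (#|F|%:R ^+ i)^-1) :> R.
Proof.
have Q0 : #|F|%:R != 0 :> R.
  by rewrite pnatr_eq0 -lt0n (ltnW (card_finNzRing_gt1 F)).
rewrite card_unitmx; elim: s => [|s IHs].
  by rewrite !big_geq // mulr1 muln1.
rewrite binS bin1 expnD !(big_nat_recr s.+1) //= mulnACA natrM IHs.
rewrite natrM natrB ?expn_gt0 ?(ltnW (card_finNzRing_gt1 F)) // !natrX.
have -> : (s.+1 * s.+1 = s * s + (s + s.+1))%N by ring.
rewrite !exprD; field.
by rewrite expf_neq0.
Qed.

(** * Kernels as subspaces and the blocking property *)

Definition mxker (F : fieldType) (n s : nat) (A : 'M[F]_(n, s)) :
    {vspace 'rV[F]_n} :=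
  lker (linfun (mulmxr A)).

Lemma mem_mxker (F : fieldType) (n s : nat) (A : 'M[F]_(n, s)) u :
  (u \in mxker A) = (u *m A == 0).
Proof. by rewrite memv_ker lfunE. Qed.

(** Every [v] is the image of [v *m invmx (B *m A) *m B], so [A] acts surjectively and rank-nullity
    applies. *)
Lemma dim_mxker (F : fieldType) (n s : nat) (A : 'M[F]_(n, s))
    (B : 'M[F]_(s, n)) :
  B *m A \in unitmx -> \dim (mxker A) = (n - s)%N.
Proof.
move=> BA; pose f : 'Hom('rV[F]_n, 'rV[F]_s) := linfun (mulmxr A).
have := limg_ker_dim f fullv.
rewrite capfv -/(mxker A).
have -> : (f @: fullv = fullv)%VS.
  apply/eqP; rewrite eqEsubv subvf; apply/subvP => v _.
  apply/memv_imgP; exists (v *m invmx (B *m A) *m B); first exact: memvf.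
  by rewrite lfunE /= -(mulmxA _ B) mulmxKV.
by rewrite !dimvf /dim /= !mul1n => dimE; rewrite -[in RHS]dimE addnK.
Qed.

Lemma exists_supspace (F : fieldType) (vT : vectType F) (U : {vspace vT})
    (k : nat) :
  (\dim U <= k <= \dim {:vT})%N ->
  exists2 H : {vspace vT}, (U <= H)%VS & \dim H = k.
Proof.
case/andP; elim: k => [|k IHk] leUk lek.
  by exists U => //; apply/eqP; rewrite -leqn0.
move: leUk; rewrite leq_eqVlt => /predU1P[<-|ltUk]; first by exists U.
have [H leUH dimH] := IHk ltUk (ltnW lek).
have /subvPn[v _ vH] : ~~ (fullv <= H)%VS.
  by apply/negP => /dimvS; rewrite dimH leqNgt lek.
exists (H + <[v]>)%VS; first exact: subv_trans leUH (addvSl _ _).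
have v0 : v != 0 by apply: contraNneq vH => ->; rewrite mem0v.
rewrite dimv_disjoint_sum ?dimH ?dim_vline ?v0 ?addn1 //.
apply/eqP; rewrite -subv0; apply/subvP => w /memv_capP[wH /vlineP[c wE]].
rewrite memv0 wE; move: wH; rewrite wE.
by rewrite rpredZeq (negbTE vH) orbF => /eqP->; rewrite scale0r.
Qed.

Lemma row_free_basis (F : fieldType) (n : nat) (H : {vspace 'rV[F]_n}) :
  exists2 B : 'M[F]_(\dim H, n), row_free B &
    forall v, v \in H -> exists c, v = c *m B.
Proof.
pose B := \matrix_(i < \dim H) (vbasis H)`_i.
have mulB c : c *m B = \sum_i c 0 i *: (vbasis H)`_i.
  by rewrite mulmx_sum_row; apply: eq_bigr => i _; rewrite rowK.
exists B; last first.
  move=> v vH; exists (\row_i coord (vbasis H) i v).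
  by rewrite mulB [LHS](coord_vbasis vH); apply: eq_bigr => i _; rewrite mxE.
apply/inj_row_free => c; rewrite mulB => c0; apply/rowP => i; rewrite mxE.
by have /freeP/(_ (c 0) c0 i) := basis_free (vbasisP H).
Qed.

(* S is unconstrained where A i has rank below s: the random choice of A does
   not exclude such matrices, whose kernels are too large. *)
Lemma strong_blocking_mxker (F : finFieldType) (N s m : nat)
    (A : 'I_m -> 'M[F]_(N.+1, s)) :
  (s <= N)%N ->
  (forall B : 'M[F]_(s, N.+1), row_free B -> exists i, B *m A i \in unitmx) ->
  forall S : 'I_m -> pg_subspace F N,
  (forall i, \dim (mxker (A i)) = (N.+1 - s)%N -> S i = mxker (A i)) ->
  strong_blocking_set s.+1 (\bigcup_(i < m) pg_points (S i)).
Proof.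
move=> sN transA S SE; split.
  apply/subsetP => P /bigcupP[i _]; rewrite !inE => /andP[-> _].
  exact: subvf.
move=> L /eqP; rewrite /pg_dim (inj_eq (addIr _)) eqz_nat => /eqP dimL.
set W := pg_span _.
have WL : (W <= L)%VS.
  apply/subv_sumP => P; rewrite !inE => /andP[_ /andP[_]]; exact: id.
apply/eqP; rewrite eqEdim WL dimL /= ltnNge; apply/negP => dimW.
have dimF : \dim {:'rV[F]_N.+1} = N.+1 by rewrite dimvf /dim /= mul1n.
(* [W] may have dimension below [s]; it is enlarged to [H] so that a basis of [H] is an [s]-row
   matrix for [transA]. *)
have [|H WH dimH] := @exists_supspace _ _ W s; first by rewrite dimW dimF ltnW.
have [B freeB spanB] := row_free_basis H.
rewrite dimH in B freeB spanB.
have [i BA] := transA B freeB.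
have dimK := dim_mxker BA.
have SiE := SE i dimK.
(* The dimensions s + 1 and N + 1 - s add up to N + 2, one more than the whole space has. *)
have : (0 < \dim (L :&: mxker (A i)))%N.
  have := dimv_sum_cap L (mxker (A i)); rewrite dimL dimK.
  have := dimvS (subvf (L + mxker (A i))%VS); rewrite dimF; lia.
rewrite lt0n dimv_eq0 -subv0 => /subvPn[v /memv_capP[vL vK]].
rewrite memv0 => v0; case/negP: (v0).
(* The point spanned by [v] lies on [L] and on [S i], so it is one of those spanning [W]. *)
have vH : v \in H.
  apply: (subvP WH); apply: (subvP (sumv_sup <[v]>%VS _ (subvv _))); last first.
    exact: memv_line.
  have Pv : pg_dim (<[v]>%VS : pg_subspace F N) == 0.
    by rewrite /pg_dim dim_vline v0 subrr.
  rewrite inE; apply/andP; split; last by rewrite inE Pv -memvE.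
  by apply/bigcupP; exists i => //; rewrite inE Pv -memvE SiE.
have [c vE] := spanB v vH.
move: vK; rewrite mem_mxker vE -mulmxA => /eqP cBA.
by rewrite -(mulmxK BA c) cBA !mul0mx.
Qed.

(** * Choice of [m] and of the subspaces *)

Theorem theorem6p5 (R : realType) (q : nat)
    (hq : exists p h : nat, [/\ prime p, (0 < h)%N & q = (p ^ h)%N])
    (F : finFieldType) (hF : #|F| = q) (N t : nat)
    (hN : (1 <= N)%N) (ht : (1 <= t <= N.+1)%N) :
  exists m : nat,
    m%:Z = Num.ceil ((N%:R - t%:R + 2) * (t%:R - 1) * c1 R q + c2 R q) /\
    exists S : 'I_m -> pg_subspace F N,
      (forall i, pg_dim (S i) = N%:Z - t%:Z + 1) /\
      strong_blocking_set t (\bigcup_(i < m) pg_points (S i)).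
Proof.
have q_gt1 : (1 < q)%N by rewrite -hF card_finNzRing_gt1.
case: t ht => // s; rewrite ltnS => /= sN.
set x := (_ * c1 R q + _).
have xE : x = ((N.+1 - s) * s)%:R * c1 R q + c2 R q.
  by rewrite /x natrM natrB 1?ltnW // -!natr1; congr (_ * _ + _); ring.
(* Nonnegativity lets the ceiling be a natural number. *)
have x0 : 0 <= x.
  have t0 := transversal_bound_gt0 R q.
  have t1 := transversal_bound_lt1 R q_gt1.
  rewrite xE c1_c2E // divr_ge0 ?oppr_ge0 ?ln_le0 //; last by lra.
  rewrite subr_ge0 (@le_trans _ _ 0) ?ln_le0 ?(ltW t1) //.
  by rewrite mulr_ge0 // ln_ge0 // ler1n ltnW.
have [m mE] : exists m : nat, m%:Z = Num.ceil x.
  by exists `|Num.ceil x|%N; rewrite gez0_abs // ceil_ge0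
    (lt_le_trans _ x0) // ltrN10.
exists m; split => //.
pose p : R := \prod_(1 <= i < s.+1) (1 - (q%:R ^+ i)^-1).
have Q0 : 0 < q%:R :> R by rewrite ltr0n ltnW.
pose u := #|[set G : 'M[F]_s | G \in unitmx]|.
have uE : u%:R = q%:R ^+ (s * s) * p :> R.
  by rewrite /u (card_unitmx_prod R) hF.
have u_le : (u <= q ^ (s * s))%N.
  by rewrite -hF -card_mx max_card.
have lt_p : q%:R ^+ ((N.+1 - s) * s) * (1 - p) ^+ m < p.
  apply: union_bound_lt => //; first exact: transversal_bound_lt_prod.
    exact: prod_1subV_le1.
  by rewrite -xE (_ : m%:R = m%:~R) // mE ceil_ge.
have [A transA] : exists A : 'I_m -> 'M[F]_(N.+1, s),
    forall B : 'M[F]_(s, N.+1), row_free B -> exists i, B *m A i \in unitmx.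
  apply: exists_transversal_family; rewrite hF -/u.
  rewrite -(ltr_nat R) !natrM !natrX natrB // uE natrX.
  have -> : q%:R ^+ (s * s) - q%:R ^+ (s * s) * p =
    q%:R ^+ (s * s) * (1 - p) :> R.
    by ring.
  (* This split isolates the common factor q^(s^2) q^(s^2 m), whose cancellation leaves [lt_p]. *)
  have -> : (N.+1 * s = s * s + (N.+1 - s) * s)%N.
    by rewrite -mulnDl subnKC // ltnW.
  rewrite exprD exprMn -exprM mulrACA [ltRHS]mulrAC.
  by rewrite ltr_pM2l ?mulr_gt0 ?exprn_gt0.
(* Any row-free matrix yields an index [i0] whose kernel has the right dimension; it replaces the
   kernels that are too large. *)
have freeI : row_free (pid_mx s : 'M[F]_(s, N.+1)).
  by rewrite -row_leq_rank rank_pid_mx // leqW.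
have [i0 BA0] := transA _ freeI.
pose S i : pg_subspace F N :=
  if \dim (mxker (A i)) == (N.+1 - s)%N then mxker (A i) else mxker (A i0).
exists S; split=> [i|]; last first.
  apply: (@strong_blocking_mxker F N s m A sN transA S) => i dimK.
  by rewrite /S dimK eqxx.
have dimS : \dim (S i) = (N.+1 - s)%N.
  by rewrite /S; case: eqP => // _; rewrite (dim_mxker BA0).
by rewrite /pg_dim dimS; lia.
Qed.
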